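(* Let $n < \omega$ and let $X_0, \dots, X_{n+1}$ be $n+2$ Hausdorff isodyne topological spaces, each of cardinality $\omega_n$. Then the product space $\prod_{i < n+2} X_i$ is $\omega$-resolvable.
   Context: A topological space $X$ is isodyne if every nonempty open subset of $X$ has cardinality $|X|$. For a cardinal $\kappa$, a space $X$ is $\kappa$-resolvable if there is an indexed family $(D_i)_{i<\kappa}$ of dense subsets of $X$ with $D_i \cap D_j = \emptyset$ for $i \neq j$; $\omega$-resolvable is the case $\kappa=\omega$. Here $\omega_0 = \omega$, and products carry the product topology. *)

(* Defs.v *)
From mathcomp Require Import all_boot.
From mathcomp Require Import all_classical all_analysis.

Set Implicit Arguments.
Unset Strict Implicit.
Unset Printing Implicit Defensive.

Local Open Scope classical_set_scope.
Local Open Scope card_scope.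

Definition card_lt (T U : Type) (A : set T) (B : set U) : Prop :=
  (A #<= B) /\ ~ (B #<= A).

(* |A| = |B|^+ : |A| is the least cardinal strictly greater than |B|. *)
Definition card_succ_of (T U : Type) (A : set T) (B : set U) : Prop :=
  card_lt B A /\
  forall (V : Type) (C : set V), card_lt B C -> A #<= C.

(* |A| = omega_n, with omega_0 = omega and omega_(n+1) = (omega_n)^+.
   There is no type of cardinals, so this is a predicate on sets; it depends
   only on n and on the cardinality of A. *)
Fixpoint has_card_omega (n : nat) (T : Type) (A : set T) : Prop :=
  match n with
  | 0 => A #= [set: nat]
  | m.+1 => exists (U : Type) (B : set U), has_card_omega m B /\ card_succ_of A B
  end.

Definition isodyne (X : topologicalType) : Prop :=
  forall O : set X, open O -> O !=set0 -> O #= [set: X].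

(* kappa-resolvability, the cardinal kappa being given by an index type K of
   cardinality kappa; K := nat for kappa = omega. *)
Definition resolvable (K : Type) (X : topologicalType) : Prop :=
  exists D : K -> set X, (forall i, dense (D i)) /\ trivIset [set: K] D.

(* Main.v *)
Require Import Defs.
From mathcomp Require Import all_boot.
From mathcomp Require Import all_classical all_analysis.
From mathcomp Require Import wochoice.

(** It suffices to find a coloring [f] of the product by natural numbers whose
    restriction to every box of nonempty open sets is onto: the color classes
    are then disjoint dense sets ([resolvable_product]).

    In the countable case [n = 0], number the points of the two factors [X] and
    [Y], and for every [m] choose pairwise disjoint neighborhoods of the points
    numbered below [m].  A point lying in one of them has the center of that
    neighborhood as its [m]-parent, so the [m]-parent is locally constant
    around every point [x] numbered below [m], with value [x]
    ([separated_parents]).  From [(x, y)] descend to [(x', y')], where [x'] is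
    the parent of [x] at the number of [y], and [y'] is the parent of [y] at the
    number of [x'], as long as the numbers decrease.  If [A] and [B] have no
    isolated points, every pair [(x', y')] in [A * B] with [y'] numbered below
    [x'] is one descent step away from some [(x, y)] in [A * B]: choose [y] in
    [B] near [y'], then [x] in [A] near [x'], each numbered far enough.  The
    number of steps therefore takes all large values on [A * B], and composing
    it with a function [nat -> nat] with infinite fibers yields a coloring for
    which every such [A * B] has all colors ([rectangle_coloring]).  In a
    countable isodyne space nonempty open sets have no isolated points.

    For [n > 0] the topologies are forgotten: all that matters is that nonempty
    open sets have full cardinality [omega_n] ([omega_coloring]).  Well-order
    [T], of cardinality [omega_n], with initial segments of cardinality less
    than [omega_n] ([short_well_order]), and color a tuple according to its
    first coordinate [z], viewing the others inside the segment below [z].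
    Given subsets of [T] of full cardinality, some [z] in the first one has
    [omega_(n-1)] elements of each of the others below it ([common_below]), so
    for [n > 1] a coloring for [omega_(n-1)] with one coordinate less can be
    transported to that segment.  For [n = 1] the segments are countable and the
    other two coordinates are colored by [rectangle_coloring], for the topology
    induced by an injection of [T] into [nat -> bool]; every uncountable subset
    of [T] contains a countable set without isolated points
    ([crowded_subset]), which lies below all large [z]. *)

Set Implicit Arguments.
Unset Strict Implicit.
Unset Printing Implicit Defensive.

Local Open Scope classical_set_scope.
Local Open Scope card_scope.

(** * Coloring rectangles in countable Hausdorff spaces *)

Section Descent.
Variables (X Y : Type) (iX : X -> nat) (iY : Y -> nat).
Variables (p : nat -> X -> X) (q : nat -> Y -> Y).

(** Each step lowers the number of [y], so [iY y] is enough fuel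
    ([descent_fuel]). *)
Fixpoint descent (fuel : nat) (x : X) (y : Y) : nat :=
  if fuel is k.+1 then
    let x' := p (iY y) x in
    let y' := q (iX x') y in
    if (iX x' < iY y)%N && (iY y' < iX x')%N then (descent k x' y').+1 else 0%N
  else 0%N.

Lemma descent_fuel k l x y : (iY y <= k)%N -> (iY y <= l)%N ->
  descent k x y = descent l x y.
Proof.
elim: k l x y => [|k IH] [|l] x y //=.
- by rewrite leqn0 => /eqP ->; rewrite ltn0.
- by move=> _; rewrite leqn0 => /eqP ->; rewrite ltn0.
move=> yk yl; case: ifP => // /andP[h1 h2]; congr _.+1.
by have h := ltn_trans h2 h1; apply: IH; rewrite -ltnS; exact: leq_trans h _.
Qed.

Definition height x y := descent (iY y) x y.

(** This prolongs a descent upwards: the choice of [x] and [y] is constrained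
    only by their parents and by the number of [y]. *)
Lemma heightS x y x' y' : (iX x' < iY y)%N -> (iY y' < iX x')%N ->
  p (iY y) x = x' -> q (iX x') y = y' -> height x y = (height x' y').+1.
Proof.
move=> h1 h2 px qy; rewrite /height.
case E : (iY y) => [|k]; first by rewrite E in h1.
rewrite /= px qy h1 h2 /=; congr _.+1; apply: descent_fuel => //.
by rewrite -ltnS -E; exact: ltn_trans h2 h1.
Qed.

(** The 2-adic valuation serves as a function with infinite fibers. *)
Definition color x y := logn 2 (height x y).+1.

End Descent.

(** Absence of isolated points, as seen through the parents: every point of [A]
    is the [m]-parent of late points of [A]. *)
Definition recurrent (T : Type) (i : T -> nat) (p : nat -> T -> T) (A : set T) :=
  A !=set0 /\ forall a m, A a -> (i a < m)%N ->
    exists2 b, A b & (m < i b)%N /\ p m b = a.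

Lemma logn2_cofinal h k : exists j, logn 2 (h + j).+1 = k.
Proof.
have le : (h < 2 ^ k * h.*2.+1)%N.
  rewrite (@leq_trans h.*2.+1) ?leq_pmull ?expn_gt0 //.
  by rewrite ltnS -addnn leq_addr.
exists (2 ^ k * h.*2.+1 - h.+1)%N; rewrite -addSn subnKC //.
rewrite lognM ?expn_gt0 // pfactorK // [logn 2 h.*2.+1]logn_coprime ?addn0 //.
by rewrite coprime2n /= odd_double.
Qed.

(** Heights of the form [h0 + j] occur for all [j], by climbing alternately in
    [B] and in [A] from a pair [(a1, b0)] of height [h0]. *)
Lemma color_onto X Y (iX : X -> nat) (iY : Y -> nat) p q A B :
  recurrent iX p A -> recurrent iY q B ->
  forall k, exists x y, [/\ A x, B y & color iX iY p q x y = k].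
Proof.
move=> [[a0 Aa0] recA] [[b0 Bb0] recB] k.
(* The starting pair must be ordered: [b0] has a smaller number than [a1]. *)
have [a1 Aa1 [lt1 _]] := recA a0 (maxn (iX a0).+1 (iY b0)) Aa0
  (leq_maxl _ _).
have {}lt1 : (iY b0 < iX a1)%N by exact: leq_ltn_trans (leq_maxr _ _) lt1.
have climb j : exists x y, [/\ A x, B y, (iY y < iX x)%N &
    height iX iY p q x y = (height iX iY p q a1 b0 + j)%N].
  elim: j => [|j [x [y [Ax By lt_yx hj]]]]; first by exists a1, b0; rewrite addn0.
  (* First [y2]: its number is the level at which [x2] must have parent [x]. *)
  have [y2 By2 [lty2 qy2]] := recB _ _ By lt_yx.
  have [x2 Ax2 [ltx2 px2]] := recA _ _ Ax lty2.
  exists x2, y2; split => //.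
  by rewrite (heightS lty2 lt_yx px2 qy2) hj addnS.
have [j jk] := logn2_cofinal (height iX iY p q a1 b0) k.
by have [x [y [Ax By _ h]]] := climb j; exists x, y; rewrite /color h.
Qed.

(** Only finitely many points are numbered below [m], so the neighborhoods that
    separate them pairwise can be intersected into disjoint ones.  Filters
    rather than a topology are used, since the lemma is applied both to given
    spaces and to the [prefix_nbhs] below. *)
Lemma separated_parents (T : Type) (N : T -> set_system T)
    (i : T -> nat) (Q : set T) :
  (forall x, Filter (N x)) ->
  (forall x y, x <> y -> exists U V, [/\ N x U, N y V & U `&` V = set0]) ->
  set_inj Q i ->
  exists p : nat -> T -> T,
    forall m x, Q x -> (i x < m)%N -> N x [set y | p m y = x].
Proof.
move=> NF sepN injQ.
have [W NW WW] : exists2 W : T -> T -> set T, (forall x y, x <> y -> N x (W x y))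
    & forall x y, x <> y -> W x y `&` W y x = set0.
  have /choice[F FP] : forall xy : T * T, exists UV : set T * set T,
      xy.1 <> xy.2 -> [/\ N xy.1 UV.1, N xy.2 UV.2 & UV.1 `&` UV.2 = set0].
    move=> [x y]; have [->|xy] := pselect (x = y); first by exists (set0, set0).
    by have [U [V UV]] := sepN _ _ xy; exists (U, V).
  exists (fun x y => (F (x, y)).1 `&` (F (y, x)).2) => x y xy.
    have [/= NU _ _] := FP (x, y) xy.
    have [|/= _ NV _] := FP (y, x); first by move=> /= /esym.
    exact: filterI.
  have [/= _ _ UV0] := FP (x, y) xy.
  by rewrite -subset0 -UV0 => z [[Uz _] [_ Vz]]; split.
(* [W x x'] and [W x' x] are disjoint, so at most one [x] is good for [y]. *)
pose good m y x := [/\ Q x, (i x < m)%N &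
  forall x', Q x' -> (i x' < m)%N -> x' <> x -> W x x' y].
have /choice[P PP] : forall my : nat * T, exists z,
    forall x, good my.1 my.2 x -> z = x.
  move=> [m y] /=; have [[x gx]|nog] := pselect (exists x, good m y x); last first.
    by exists y => x gx; case: nog; exists x.
  exists x => x' gx'; apply: contrapT => xx'.
  have [Qx lx gx1] := gx; have [Qx' lx' gx1'] := gx'.
  have : (W x x' `&` W x' x) y by split; [apply: gx1 => // /esym|apply: gx1'].
  by rewrite WW.
exists (fun m y => P (m, y)) => m x Qx lx.
have : N x [set y | forall j : 'I_m, forall x', Q x' -> i x' = j -> x' <> x ->
    W x x' y].
  apply: filter_forall => j.
  have [[x1 [Qx1 ix1 x1x]]|no] :=
    pselect (exists x1, [/\ Q x1, i x1 = j & x1 <> x]); last first.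
    by apply: filterE => y x' Qx' ix' x'x; case: no; exists x'.
  apply: filterS (NW _ _ (fun e => x1x (esym e))) => y Wy x' Qx' ix' _.
  by rewrite (injQ x' x1) ?inE // ix1.
apply: filterS => y Wy /=.
by apply: (PP (m, y) x); split => // x' Qx' lx' x'x; exact: (Wy (Ordinal lx')).
Qed.

Definition crowded (T : Type) (N : T -> set_system T) (A : set T) :=
  A !=set0 /\ forall a O, A a -> N a O -> infinite_set (A `&` O).

Lemma crowded_recurrent (T : Type) (N : T -> set_system T) (i : T -> nat)
    (p : nat -> T -> T) (Q A : set T) :
  set_inj Q i -> A `<=` Q ->
  (forall m x, Q x -> (i x < m)%N -> N x [set y | p m y = x]) ->
  crowded N A -> recurrent i p A.
Proof.
move=> injQ AQ Np [A0 crA]; split => // a m Aa lt_am.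
have inf := crA _ _ Aa (Np m a (AQ _ Aa) lt_am).
apply: contrapT => noB; apply: inf.
apply: (@card_le_finite _ _ _ `I_m.+1); last exact: finite_II.
have : set_fun (A `&` [set y | p m y = a]) `I_m.+1 i.
  move=> b [Ab pb] /=; rewrite ltnS leqNgt; apply/negP => lt_mb.
  by apply: noB; exists b.
move=> fi.
have e : i @` (A `&` [set y | p m y = a]) #= A `&` [set y | p m y = a].
  apply: inj_card_eq => x y; rewrite !inE => -[Ax _] [Ay _].
  by apply: injQ; rewrite inE; exact: AQ.
rewrite -(card_le_eql e).
by apply: subset_card_le => _ [b Sb <-]; exact: fi.
Qed.

Lemma rectangle_coloring (X Y : Type) (NX : X -> set_system X)
    (NY : Y -> set_system Y) (P : set X) (Q : set Y) :
  (forall x, Filter (NX x)) -> (forall y, Filter (NY y)) ->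
  (forall x y, x <> y -> exists U V, [/\ NX x U, NX y V & U `&` V = set0]) ->
  (forall x y, x <> y -> exists U V, [/\ NY x U, NY y V & U `&` V = set0]) ->
  countable P -> countable Q ->
  exists c : X -> Y -> nat, forall A B, A `<=` P -> B `<=` Q ->
    crowded NX A -> crowded NY B ->
    forall k, exists x y, [/\ A x, B y & c x y = k].
Proof.
move=> FX FY sepX sepY /countable_injP[iX injX] /countable_injP[iY injY].
have [p Np] := separated_parents FX sepX injX.
have [q Nq] := separated_parents FY sepY injY.
exists (color iX iY p q) => A B AP BQ crA crB; apply: color_onto.
  exact: crowded_recurrent injX AP Np crA.
exact: crowded_recurrent injY BQ Nq crB.
Qed.

(** * Well-orders with short initial segments *)

Record strict_well_order (T : Type) (lt : T -> T -> Prop) : Prop := {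
  swo_irr : forall x, ~ lt x x;
  swo_tri : forall x y, [\/ lt x y, x = y | lt y x];
  swo_min : forall A : set T, A !=set0 ->
    exists2 x, A x & forall y, A y -> ~ lt y x }.

Definition below (T : Type) (lt : T -> T -> Prop) (z : T) : set T :=
  [set y | lt y z].

Lemma exists_strict_well_order (T : Type) :
  exists lt : T -> T -> Prop, strict_well_order lt.
Proof.
have [R Rwo] := well_ordering_principle {classic T}.
have Rwo' : wo_chain R predT by exact: withinW.
have Rtot x y := wo_chainW Rwo' (isT : x \in predT) (isT : y \in predT).
have Ranti x y := wo_chain_antisymmetric Rwo' (isT : x \in predT) (isT : y \in predT).
exists (fun x y => ~~ R y x); split.
- by move=> x; apply/negP; rewrite negbK; have := Rtot x x; rewrite orbb.
- move=> x y; case yx: (R y x); last by constructor 1.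
  case xy: (R x y); last by constructor 3.
  by constructor 2; apply: Ranti; rewrite xy yx.
- move=> A [a Aa].
  have [|x [[xA minx] _]] := Rwo [pred x | `[< A x >]].
    by exists a; exact/asboolP.
  exists x; first exact/asboolP.
  by move=> y Ay; apply/negP; rewrite negbK; apply: minx; exact/asboolP.
Qed.

Lemma countableU T (A B : set T) :
  countable A -> countable B -> countable (A `|` B).
Proof.
move=> cA cB; rewrite -bigcup2E; apply: bigcup_countable => // -[|[|i]] _ //=.
Qed.

Lemma card_le_inj T U (A : set T) (B : set U) (u : U) : A #<= B ->
  exists2 f : T -> U, set_fun A B f & set_inj A f.
Proof.
move=> /card_leP[g]; pose f x := if pselect (A x) is left Ax
  then set_val (g (SigSub (mem_set Ax))) else u.
exists f => [x Ax|x y /set_mem Ax /set_mem Ay]; rewrite /f.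
  by case: pselect => // Ax'; exact: set_valP.
case: pselect => // Ax'; case: pselect => // Ay' /val_inj gxy.
by have [] := 'inj_g (mem_set Logic.I) (mem_set Logic.I) gxy.
Qed.

Lemma swo_wf (T : Type) (lt : T -> T -> Prop) :
  strict_well_order lt -> well_founded lt.
Proof.
move=> wo x; apply: contrapT => nx.
have [|y ny miny] := swo_min wo (A := [set y | ~ Acc lt y]); first by exists x.
apply: ny; constructor => z zy; apply: contrapT => nz; exact: miny nz zy.
Qed.

Section WellOrder.
Variables (T : Type) (lt : T -> T -> Prop).
Hypothesis wo : strict_well_order lt.

Lemma swo_trans x y z : lt x y -> lt y z -> lt x z.
Proof.
move=> xy yz.
have [|m Am minm] := swo_min wo (A := [set x; y; z]); first by exists x; left; left.
have xm : ~ lt x m by apply: minm; left; left.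
have ym : ~ lt y m by apply: minm; left; right.
have zm : ~ lt z m by apply: minm; right.
case: Am => [[]|] /= mE; subst m => //.
by case: (swo_tri wo x z) => // xz; subst z.
Qed.

Lemma swo_lt_le_trans x y z : lt x y -> ~ lt z y -> lt x z.
Proof.
move=> xy zy; case: (swo_tri wo y z) => [yz|<-//|//].
exact: swo_trans xy yz.
Qed.

Lemma swo_bound m (z : 'I_m -> T) (w0 : T) : exists w, forall i, ~ lt w (z i).
Proof.
elim: m z => [|m IH] z; first by exists w0 => -[].
have [w wP] := IH (fun i => z (lift ord0 i)).
have [lt_wz|nlt] := pselect (lt w (z ord0)).
  exists (z ord0) => i; case: (unliftP ord0 i) => [j|] ->; last exact: swo_irr.
  move=> h; apply: (wP j); exact: swo_trans lt_wz h.
by exists w => i; case: (unliftP ord0 i) => [j|] ->.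
Qed.

(** Enumerate [A] in increasing order along a well-order of [B]: unless [A] is
    exhausted, the values taken lie below the first element [z] left over.
    With [A] the whole type this contains the comparability of cardinals. *)
Lemma card_le_or_below U (A : set T) (B : set U) :
  A #<= B \/ exists2 z, A z & B #<= A `&` below lt z.
Proof.
have [AB|nAB] := pselect (A #<= B); [by left|right].
have [lu uwo] := exists_strict_well_order U.
have nonempty (D : set U) (F : U -> T) : D `<=` B -> (A `\` F @` D) !=set0.
  move=> DB; apply/set0P/eqP; rewrite setD_eq0 => AF; apply: nAB.
  apply: card_le_trans (subset_card_le AF) _.
  exact: card_le_trans (card_image_le _ _) (subset_card_le DB).
have [least leastP] : exists least : set T -> T, forall D, D !=set0 ->
    D (least D) /\ forall y, D y -> ~ lt y (least D).
  have [a Aa] : A !=set0.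
    by apply/set0P/eqP => A0; apply: nAB; rewrite A0 card_ge0.
  have /choice[l lP] : forall D : set T, exists x, D !=set0 ->
      D x /\ forall y, D y -> ~ lt y x.
    move=> D; have [/(swo_min wo)[x Dx xmin]|D0] := pselect (D !=set0).
      by exists x.
    by exists a.
  by exists l.
have lwf := swo_wf uwo.
(* [F b] is the least element of [A] that is not [F b'] for an earlier [b']. *)
pose step (b : U) (rec : forall b', lu b' b -> T) : T :=
  least (A `\` [set t | exists b' (h : lu b' b), B b' /\ rec b' h = t]).
pose F := Fix lwf (fun _ => T) step.
have FE b : F b = least (A `\` F @` (B `&` below lu b)).
  rewrite /F Fix_eq; last first.
    by move=> x f g fg; congr step; apply: functional_extensionality_dep => y;
       apply: functional_extensionality_dep.
  rewrite /step; congr (least (A `\` _)); apply/seteqP; split => t /=.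
    by move=> [b' [h [Bb' <-]]]; exists b'.
  by move=> [b' [Bb' h] <-]; exists b', h.
have FP b : [/\ A (F b), ~ (F @` (B `&` below lu b)) (F b) &
    forall y, A y -> ~ (F @` (B `&` below lu b)) y -> ~ lt y (F b)].
  rewrite FE; have [|[h1 h2] h3] := leastP (A `\` F @` (B `&` below lu b)).
    by apply: nonempty => x [].
  by split => // y Ay ny; apply: h3.
have [|[Az nz] _] := leastP (A `\` F @` B); first exact: nonempty.
set z := least _ in Az nz; exists z => //.
have injF : {in B &, injective F}.
  move=> b c; rewrite !inE => Bb Bc Fbc; case: (swo_tri uwo b c) => // h.
    by have [_ + _] := FP c; case; exists b.
  by have [_ + _] := FP b; case; exists c.
rewrite -(card_le_eql (inj_card_eq injF)); apply: subset_card_le => _ [b Bb <-].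
have [AF _ minF] := FP b; split => //; case: (swo_tri wo (F b) z) => // h.
  by case: nz; exists b.
case: (minF z) => // -[b' [Bb' _] Fb']; apply: nz; by exists b'.
Qed.

End WellOrder.

(** If some segment of a well-order of [T] is not of cardinality at most that of
    [B], the first such segment has at least the cardinality of [T], because
    that is the successor cardinal; pull the order back along an injection of
    [T] into this segment. *)
Lemma short_well_order T U (B : set U) : card_succ_of [set: T] B ->
  exists2 lt : T -> T -> Prop, strict_well_order lt &
    forall z, below lt z #<= B.
Proof.
move=> [_ succB]; have [lt wo] := exists_strict_well_order T.
have [short|] := pselect (forall z, below lt z #<= B); first by exists lt.
move=> /existsNP tall.
have [z tallz minz] := swo_min wo (A := [set z | ~ (below lt z #<= B)]) tall.
have /succB : card_lt B (below lt z).
  split => //; case: (card_le_or_below wo (below lt z) B) => // -[y _].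
  by move=> /card_le_trans; apply; apply: subset_card_le => t [].
move=> /(card_le_inj z)[g gz ginj].
exists (fun x y => lt (g x) (g y)); first split.
- by move=> x; exact: swo_irr.
- move=> x y; case: (swo_tri wo (g x) (g y)); [by constructor 1| |by constructor 3].
  by move=> gxy; constructor 2; apply: ginj; rewrite ?inE.
- move=> A [a Aa].
  have [|_ [x Ax <-] minx] := swo_min wo (A := g @` A); first by exists (g a), a.
  by exists x => // y Ay; apply: minx; exists y.
move=> x; have -> : below (fun x y => lt (g x) (g y)) x = g @^-1` below lt (g x).
  by [].
have : below lt (g x) #<= B.
  by apply: contrapT => tallx; apply: (minz _ tallx); exact: gz.
apply: card_le_trans; apply: card_ge_preimage => u v _ _; apply: ginj; by rewrite inE.
Qed.

Section Unbounded.
Variables (T U : Type) (B : set U) (lt : T -> T -> Prop).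
Hypothesis wo : strict_well_order lt.
Hypothesis short : forall z, below lt z #<= B.

(** By [card_le_or_below] each [A i] already has [B] many elements below some
    [z i], and a set that is not of cardinality at most that of [B] cannot lie
    below an upper bound of the finitely many [z i]. *)
Lemma common_below m (A0 : set T) (A : 'I_m -> set T) :
  ~ (A0 #<= B) -> (forall i, ~ (A i #<= B)) ->
  exists2 z, A0 z & forall i, B #<= A i `&` below lt z.
Proof.
move=> big0 big.
have /choice[z zP] : forall i, exists z, B #<= A i `&` below lt z.
  by move=> i; case: (card_le_or_below wo (A i) B) => [/big //|[z _]]; exists z.
have [a0 Aa0] : A0 !=set0.
  by apply/set0P/eqP => A00; apply: big0; rewrite A00 card_ge0.
have [w wz] := swo_bound wo z a0.
have [y Ay lt_yw] : exists2 y, A0 y & ~ lt y w.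
  apply: contrapT => no; apply: big0; apply: card_le_trans (short w).
  by apply: subset_card_le => y Ay; apply: contrapT => yw; apply: no; exists y.
exists y => // i; apply: card_le_trans (zP i) _; apply: subset_card_le => t [At tz].
split => //; apply: swo_lt_le_trans lt_yw => //; exact: swo_lt_le_trans (wz i).
Qed.

Lemma countable_below (A0 C : set T) : countable B ->
  ~ countable A0 -> countable C -> exists2 z, A0 z & C `<=` below lt z.
Proof.
move=> cB big0 cC; apply: contrapT => no; apply: big0.
apply: (@sub_countable _ _ _ (\bigcup_(c in C) ([set c] `|` below lt c))); last first.
  apply: bigcup_countable => // c _; apply: countableU; first exact: countable1.
  exact: sub_countable (short c) cB.
apply: subset_card_le => y Ay; apply: contrapT => ny; apply: no; exists y => // c Cc.
by case: (swo_tri wo c y) => // h; case: ny; exists c => //; [left|right].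
Qed.

End Unbounded.

(** * The first uncountable cardinal *)

Lemma inj_card_leT T U (f : T -> U) (A : set U) :
  injective f -> (forall x, A (f x)) -> [set: T] #<= A.
Proof.
move=> fi fA; rewrite -(card_le_eql (inj_card_eq (in2W fi))).
by apply: subset_card_le => _ [x _ <-].
Qed.

Lemma card_lt_nat_cantor : card_lt [set: nat] [set: nat -> bool].
Proof.
split.
  apply: (@inj_card_leT _ _ (fun n m => m == n)) => // n m /funeqP/(_ n).
  by rewrite eqxx => /esym/eqP.
move=> /(card_le_inj 0%N)[g _ ginj].
pose d n := `[< exists h, g h = n /\ ~~ h n >].
have ndgd : ~~ d (g d).
  apply/negP => dgd; have /asboolP[h [gh]] := dgd.
  by rewrite (ginj h d) ?inE // dgd.
by case/negP: (ndgd); apply/asboolP; exists d.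
Qed.

(** Neighborhoods for the topology induced by [r] from the Cantor space. *)
Definition prefix_nbhs (T : Type) (r : T -> nat -> bool) (a : T) : set_system T :=
  [set O | exists n, forall b, (forall i, (i < n)%N -> r b i = r a i) -> O b].

Lemma prefix_nbhs_filter T (r : T -> nat -> bool) a : Filter (prefix_nbhs r a).
Proof.
split; first by exists 0%N.
- move=> P Q [n nP] [m mQ]; exists (maxn n m) => b ba; split.
    by apply: nP => i lt_in; apply: ba; rewrite leq_max lt_in.
  by apply: mQ => i lt_im; apply: ba; rewrite leq_max lt_im orbT.
- by move=> P Q PQ [n nP]; exists n => b /nP/PQ.
Qed.

Lemma prefix_nbhs_separated T (r : T -> nat -> bool) : injective r ->
  forall x y, x <> y ->
  exists U V, [/\ prefix_nbhs r x U, prefix_nbhs r y V & U `&` V = set0].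
Proof.
move=> rinj x y xy; have [i rxy] : exists i, r x i <> r y i.
  by apply: contrapT => /forallNP e; apply/xy/rinj/funext => i; apply: contrapT.
exists [set b | r b i = r x i], [set b | r b i = r y i]; split.
- by exists i.+1 => b; apply.
- by exists i.+1 => b; apply.
- by rewrite -subset0 => b [/= -> /rxy].
Qed.

(** The Cantor space has a countable base: discard from [A] its countable traces
    on the basic sets, and pick infinitely many of the remaining points in every
    basic set that contains one. *)
Lemma crowded_subset T (r : T -> nat -> bool) (A : set T) : ~ countable A ->
  exists C, [/\ C `<=` A, countable C & crowded (prefix_nbhs r) C].
Proof.
move=> bigA.
pose cyl (s : seq bool) := [set a | forall i, (i < size s)%N -> r a i = nth false s i].
pose D := \bigcup_(s in [set s | countable (A `&` cyl s)]) (A `&` cyl s).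
have cD : countable D by apply: bigcup_countable.
pose A' := A `\` D.
have infcyl s a : A' a -> cyl s a -> infinite_set (A' `&` cyl s).
  move=> [Aa Da] sa fin; apply: Da; exists s => //=.
  apply: (@sub_countable _ _ _ ((A' `&` cyl s) `|` D)).
    apply: subset_card_le => b [Ab sb].
    by have [Db|Db] := pselect (D b); [right|left].
  by apply: countableU => //; exact: finite_set_countable.
have [a0 A'a0] : A' !=set0.
  apply/set0P/eqP; rewrite setD_eq0 => AD; apply: bigA.
  exact: sub_countable (subset_card_le AD) cD.
have /choice[g gP] : forall s, exists g : nat -> T, infinite_set (A' `&` cyl s) ->
    (forall n, (A' `&` cyl s) (g n)) /\ injective g.
  move=> s; have [inf|fin] := pselect (infinite_set (A' `&` cyl s)).
    have /infiniteP/(card_le_inj a0)[g gS ginj] := inf; exists g => _; split.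
      by move=> n; exact: gS.
    by move=> n m; apply: ginj; rewrite inE.
  by exists (fun=> a0).
exists (\bigcup_(s in [set s | infinite_set (A' `&` cyl s)]) range (g s)); split.
- by move=> _ [s /= /gP[gs _] [n _ <-]]; have [[]] := gs n.
- apply: bigcup_countable => // s _; exact: sub_countable (card_image_le _ _) _.
split.
  have inf0 : infinite_set (A' `&` cyl [::]) by exact: infcyl A'a0 _.
  by exists (g [::] 0%N), [::] => //; exists 0%N.
move=> _ O [s /= /gP[gs _] [n _ <-]] [m mO].
have [A'a _] := gs n; set a := g s n in A'a mO *.
have cyla b : cyl (mkseq (r a) m) b -> O b.
  move=> ba; apply: mO => i lt_im; rewrite ba ?size_mkseq //.
  by rewrite nth_mkseq.
have infa : infinite_set (A' `&` cyl (mkseq (r a) m)).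
  apply: (infcyl _ _ A'a) => i; rewrite size_mkseq => lt_im; by rewrite nth_mkseq.
have [ga gainj] := gP _ infa.
apply/infiniteP; apply: (inj_card_leT gainj) => k; split.
  by exists (mkseq (r a) m) => //; exists k.
by apply: cyla; have [] := ga k.
Qed.

(** The first coordinate [z] selects a coloring of pairs from the countable
    segment below [z].  The injection [r] into the Cantor space exists because
    [T] has the least uncountable cardinality. *)
Lemma triple_coloring T U (B : set U) : B #= [set: nat] ->
  card_succ_of [set: T] B ->
  exists f : T -> T -> T -> nat, forall A0 A1 A2,
    ~ countable A0 -> ~ countable A1 -> ~ countable A2 ->
    forall k, exists x y z, [/\ A0 x, A1 y, A2 z & f x y z = k].
Proof.
move=> Bnat succB; have cB : countable B by rewrite (eq_countable Bnat).
have [r rinj] : exists r : T -> nat -> bool, injective r.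
  have /(card_le_inj (fun=> false))[r _ rinj] : [set: T] #<= [set: nat -> bool].
    apply: succB.2; have [le nle] := card_lt_nat_cantor; split.
      by rewrite (card_le_eql Bnat).
    by rewrite (card_le_eqr Bnat).
  by exists r => x y; apply: rinj; rewrite inE.
have [lt wo short] := short_well_order succB.
have NF := prefix_nbhs_filter r.
have Nsep := prefix_nbhs_separated rinj.
have /choice[c cP] z := rectangle_coloring NF NF Nsep Nsep
  (sub_countable (short z) cB) (sub_countable (short z) cB).
exists c => A0 A1 A2 big0 big1 big2 k.
have [C1 [CA1 cC1 cr1]] := crowded_subset r big1.
have [C2 [CA2 cC2 cr2]] := crowded_subset r big2.
have [z Az Cz] := countable_below wo short cB big0 (countableU cC1 cC2).
have [||x [y [C1x C2y cxy]]] := cP z C1 C2 _ _ cr1 cr2 k.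
- by move=> x Cx; apply: Cz; left.
- by move=> x Cx; apply: Cz; right.
by exists z, x, y; split => //; [exact: CA1|exact: CA2].
Qed.

(** * All larger finite alephs *)

Lemma has_card_omega_eq n T U (A : set T) (B : set U) :
  A #= B -> has_card_omega n A -> has_card_omega n B.
Proof.
move=> AB; case: n => [|n] /=; first by rewrite (card_eql AB).
move=> [V [C [nC [[CA AC] succA]]]]; exists V, C; split => //; split; first split.
- by rewrite -(card_le_eqr AB).
- by rewrite -(card_le_eql AB).
- by move=> W D CD; rewrite -(card_le_eql AB); exact: succA.
Qed.

Lemma has_card_omega_unique n T U (A : set T) (B : set U) :
  has_card_omega n A -> has_card_omega n B -> A #= B.
Proof.
elim: n T U A B => [|n IH] T U A B /=.
  by move=> hA hB; exact: card_eq_trans hA (card_esym hB).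
move=> [V [C [nC [ltA minA]]]] [W [D [nD [ltB minB]]]].
have CD := IH _ _ _ _ nC nD.
have swap V1 V2 V3 (E : set V1) (E' : set V2) (G : set V3) :
    E #= E' -> card_lt E G -> card_lt E' G.
  by move=> e []; rewrite (card_le_eql e) (card_le_eqr e).
rewrite card_eq_le minA ?minB //; first exact: swap CD ltA.
exact: swap (card_esym CD) ltB.
Qed.

(** In the induction step the first coordinate [z] carries an injection [e z] of
    the segment below it into a set of the preceding cardinality, through which
    the coloring [g] of the remaining coordinates is transported. *)
Lemma omega_coloring n (T : Type) : has_card_omega n.+1 [set: T] ->
  exists f : ('I_n.+3 -> T) -> nat,
    forall A : 'I_n.+3 -> set T, (forall i, [set: T] #<= A i) ->
    forall k, exists2 x, (forall i, A i (x i)) & f x = k.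
Proof.
elim: n T => [|n IH] T [U [B [nB succB]]].
  have [f fP] := triple_coloring nB succB.
  have big (A : set T) : [set: T] #<= A -> ~ countable A.
    move=> TA; rewrite /countable -(card_le_eqr nB) => AB.
    by apply: succB.1.2; exact: card_le_trans TA AB.
  exists (fun x => f (x ord0) (x (inord 1)) (x ord_max)) => A AT k.
  have [x [y [z [Ax Ay Az fk]]]] := fP _ _ _ (big _ (AT ord0))
    (big _ (AT (inord 1))) (big _ (AT ord_max)) k.
  exists (fun i : 'I_3 => nth x [:: x; y; z] i); last by rewrite /= inordK.
  move=> i; have := ltn_ord i; case E : (nat_of_ord i) => [|[|[|]]] //= _.
  - by rewrite (_ : i = ord0) //; exact: val_inj.
  - by rewrite (_ : i = inord 1) //; apply: val_inj; rewrite /= inordK.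
  - by rewrite (_ : i = ord_max) //; exact: val_inj.
pose V : Type := set_type B.
have VB : [set: V] #= B by exact: card_setT.
have nV : has_card_omega n.+1 [set: V] by exact: (has_card_omega_eq (n := n.+1) (card_esym VB) nB).
have [g gP] := IH V nV.
(* Since [g] takes a value, [V] is inhabited, which makes the [e z] total. *)
have [x0 _ _] := gP (fun=> setT) (fun=> card_lexx _) 0%N.
have [lt wo short] := short_well_order succB.
have /choice[e einj] z : exists e : T -> V, set_inj (below lt z) e.
  have := short z; rewrite -(card_le_eqr VB) => /(card_le_inj (x0 ord0))[e _ ei].
  by exists e.
exists (fun x => g (fun i => e (x ord0) (x (lift ord0 i)))) => A AT k.
have big (A' : set T) : [set: T] #<= A' -> ~ (A' #<= B).
  by move=> TA AB; apply: succB.1.2; exact: card_le_trans TA AB.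
have [z Az zP] := common_below wo short (big _ (AT ord0))
  (fun i => big _ (AT (lift ord0 i))).
have [|x xP gx] := gP (fun i => e z @` (A (lift ord0 i) `&` below lt z)) _ k.
  move=> i; rewrite (card_le_eql VB); apply: card_le_trans (zP i) _.
  have ee : e z @` (A (lift ord0 i) `&` below lt z) #= A (lift ord0 i) `&` below lt z.
    by apply: inj_card_eq => a b /set_mem[_ az] /set_mem[_ bz];
       apply: einj; rewrite inE.
  by rewrite (card_le_eqr ee).
have /choice[y yP] i : exists y, A (lift ord0 i) y /\ e z y = x i.
  by have [y [Ay _] yx] := xP i; exists y.
exists (fun i => oapp y z (unlift ord0 i)).
  by move=> i; case: (unliftP ord0 i) => [j|] -> //=; have [] := yP j.
rewrite unlift_none /= -gx; congr g; apply/funext => i.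
by rewrite liftK /=; have [] := yP i.
Qed.

(** * From colorings to resolvability *)

(** The filter of all boxes, restricted in arbitrarily many coordinates,
    converges to [x], as its projections do. *)
Lemma product_nbhs_box (I : eqType) (X : I -> topologicalType) (x : prod_topology X)
    (O : set (prod_topology X)) : nbhs x O ->
  exists2 W : forall i, set (X i), (forall i, nbhs (x i) (W i)) &
    forall y : prod_topology X, (forall i, W i (y i)) -> O y.
Proof.
pose box (W : forall i, set (X i)) : set (prod_topology X) :=
  [set y | forall i, W i (y i)].
pose F := filter_from [set W : forall i, set (X i) | forall i, nbhs (x i) (W i)] box.
have FF : Filter F.
  apply: filter_from_filter.
    by exists (fun=> setT) => i; exact: filterT.
  move=> V W nV nW; exists (fun i => V i `&` W i).
    by move=> i; exact: filterI.
  by move=> y yVW; split => i; have [] := yVW i.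
suff : F --> x by move=> Fx /Fx[W nW WO]; exists W.
apply/cvg_sup => i V; rewrite nbhsE => -[V' [[W oW WV'] V'x] V'V].
exists (dfwith (fun j => [set: X j]) i W); last first.
  move=> y /(_ i); rewrite dfwithin => Wy; apply: V'V; by rewrite -WV'.
move=> j /=.
case: (dfwithP (fun j => [set: X j]) W) => [|j' _].
  by apply: open_nbhs_nbhs; split => //; move: V'x; rewrite -WV'.
exact: filterT.
Qed.

Lemma resolvable_product (I : eqType) (X : I -> topologicalType)
    (f : (forall i, X i) -> nat) :
  (forall O : forall i, set (X i), (forall i, open (O i)) ->
    (forall i, O i !=set0) ->
    forall k, exists2 x, (forall i, O i (x i)) & f x = k) ->
  resolvable nat (prod_topology X).
Proof.
move=> fP; exists (fun k => [set x | f x = k]); split; last first.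
  by move=> j k _ _ [x [<- <-]].
move=> k O [x Ox] oO.
have [W nW WO] := product_nbhs_box (open_nbhs_nbhs (conj oO Ox)).
have [||y yW fy] := fP (fun i => interior (W i)) _ _ k.
- by move=> i; exact: open_interior.
- by move=> i; exists (x i); exact: nW.
by exists y; split => //; apply: WO => i; exact: interior_subset.
Qed.

(** A nonempty open set is as large as the space, hence infinite; so a nonempty
    open set meets every neighborhood of each of its points in infinitely many
    points. *)
Lemma countable_product (X : 'I_2 -> topologicalType) :
  (forall i, hausdorff_space (X i)) -> (forall i, isodyne (X i)) ->
  (forall i, [set: X i] #= [set: nat]) -> resolvable nat (prod_topology X).
Proof.
move=> T2 isoX cX.
have sep i (x y : X i) : x <> y ->
    exists U V, [/\ nbhs x U, nbhs y V & U `&` V = set0].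
  move=> /eqP xy; have := T2 i; rewrite open_hausdorff => /(_ x y xy).
  move=> [[U V] [/= /set_mem Ux /set_mem Vy] [oU oV /eqP UV]].
  by exists U, V; split => //; apply: open_nbhs_nbhs.
have cr i (O : set (X i)) : open O -> O !=set0 -> crowded (@nbhs _ (X i)) O.
  move=> oO O0; split => // a V Oa nV.
  have inf : infinite_set (O `&` interior V).
    apply/infiniteP; rewrite -(card_le_eql (cX i)).
    have /isoX : open (O `&` interior V) by apply: openI => //; exact: open_interior.
    by move=> e; rewrite (card_le_eqr (e _)) //; exists a.
  by apply: sub_infinite_set inf; apply: setIS; exact: interior_subset.
have cT i : countable [set: X i] by rewrite (eq_countable (cX i)).
have [c cP] := rectangle_coloring (@nbhs_filter (X ord0)) (@nbhs_filter (X ord_max))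
  (@sep ord0) (@sep ord_max) (cT ord0) (cT ord_max).
apply: (@resolvable_product _ _ (fun x => c (x ord0) (x ord_max))) => O oO O0 k.
have [x [y [Ox Oy <-]]] := cP _ _ (@subsetT _ _) (@subsetT _ _)
  (cr _ _ (oO ord0) (O0 ord0)) (cr _ _ (oO ord_max) (O0 ord_max)) k.
exists (dfwith (dfwith (fun i => sval (cid (O0 i))) ord0 x) ord_max y).
  move=> i; case: dfwithP => // j _; case: dfwithP => // l _.
  exact: svalP (cid (O0 l)).
by rewrite dfwithin dfwithout // dfwithin.
Qed.

Theorem theorem4p5 (n : nat) (X : 'I_n.+2 -> topologicalType)
  (hausdorffX : forall i, hausdorff_space (X i))
  (isodyneX : forall i, isodyne (X i))
  (cardX : forall i, has_card_omega n [set: X i]) :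
  resolvable nat (prod_topology X).
Proof.
case: n X hausdorffX isodyneX cardX => [|n] X T2 isoX cardX.
  exact: countable_product.
have [f fP] := omega_coloring (cardX ord0).
have eqX i : [set: X i] #= [set: X ord0].
  exact: has_card_omega_unique (cardX i) (cardX ord0).
have [t0] : [set: X ord0] !=set0.
  by have [x _ _] := fP (fun=> setT) (fun=> card_lexx _) 0%N; exists (x ord0).
move=> _.
have inj i : exists e : X i -> X ord0, injective e.
  have := eqX i; rewrite card_eq_le => /andP[/(card_le_inj t0)[e _ ei] _].
  by exists e => a b; apply: ei; rewrite inE.
pose e i := sval (cid (inj i)).
have ei i : injective (e i) by exact: svalP (cid (inj i)).
apply: (@resolvable_product _ _ (fun x => f (fun i => e i (x i)))) => O oO O0 k.
have [|t tP ft] := fP (fun i => e i @` O i) _ k.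
  move=> i; rewrite (card_le_eqr (inj_card_eq (in2W (@ei i)))).
  rewrite (card_le_eqr (isoX i _ (oO i) (O0 i))).
  by rewrite (card_le_eqr (eqX i)).
pose x i := sval (cid2 (tP i)).
exists x; first by move=> i; rewrite /x; case: cid2.
by rewrite -ft; congr f; apply/funext => i; rewrite /x; case: cid2.
Qed.
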